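(* Let $p_r(n)$ denote Ramanujan's general partition function, defined for integers $n\ge 0$ and nonzero integers $r$ by $\sum_{n=0}^\infty p_r(n)q^n=\frac{1}{(q;q)_\infty^r}$ for $|q|<1$, where $(q;q)_\infty=\prod_{k=1}^\infty(1-q^{k})$. For any integer $\lambda$ with $25\lambda+1\neq 0$, every integer $n\ge 0$, and $\ell\in\{1,2,3,4\}$, we have $p_{-(25\lambda+1)}(25n+5\ell+1)\equiv 0\pmod 5$. *)

(* Defs.v *)
From mathcomp Require Import all_boot all_order all_algebra.
From mathcomp Require Import all_classical all_reals all_analysis.

Set Implicit Arguments.
Unset Strict Implicit.
Unset Printing Implicit Defensive.

Import Order.TTheory GRing.Theory Num.Theory numFieldNormedType.Exports.

Local Open Scope classical_set_scope.
Local Open Scope ring_scope.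

(* These definitions are over an arbitrary numFieldType K because the topology
   induced by the norm is inferred for K abstract; they are meant to be used
   with K := R[i], the complex numbers over a realType R. *)

Definition qpoch_inf (K : numFieldType) (q : K) : K :=
  limn (fun N : nat => \prod_(1 <= k < N.+1) (1 - q ^+ k) : K).

(* The values of p are taken in K, so that the integrality of the coefficients
   is not part of the definition. A power series expansion on the unit disc
   determines its coefficients, so at most one p satisfies this. *)
Definition is_general_partition_function (K : numFieldType) (r : int)
    (p : nat -> K) : Prop :=
  forall q : K, `|q| < 1 ->
    series (fun n : nat => p n * q ^+ n) @ \oo --> 1 / (qpoch_inf q ^ r).

(* Main.v *)
(* Every integer power of (q;q)_oo agrees, on small positive reals, with an
   integer polynomial up to O(q^(N+1)), and such a polynomial determines the
   coefficients up to q^N of a power series. So (q;q)_oo^(25 lambda + 1) may be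
   replaced by B^25 * P_N, where B approximates (q;q)_oo^lambda and
   P_N = (1 - q) ... (1 - q^N). Modulo 5, B^25 is a polynomial in q^25, while
   the exponents e = k(3k+1)/2 of Euler's pentagonal number theorem satisfy
   24 e + 1 = (6k+1)^2: if e = 1 mod 5 this square is divisible by 5, hence by
   25, and e = 1 mod 25. So no exponent is 6, 11, 16 or 21 mod 25. *)

Require Import Defs.
From mathcomp Require Import all_boot all_order all_algebra.
From mathcomp Require Import complex all_classical all_reals all_analysis.
From mathcomp Require Import zify ring.

Set Implicit Arguments.
Unset Strict Implicit.
Unset Printing Implicit Defensive.

Import Order.TTheory GRing.Theory Num.Theory numFieldNormedType.Exports.

Local Open Scope ring_scope.
Local Open Scope complex_scope.

(** * A finite form of the pentagonal number theorem *)

Definition qpoch (A : comNzRingType) (s n : nat) : {poly A} :=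
  \prod_(s <= k < n) (1 - 'X^(k.+1)).

Section PentagonalNumbers.
Variable A : comNzRingType.
Implicit Types s n : nat.

(** In q-notation, for [s <= n]: (-1)^s q^(sn + s(s+1)/2) (q;q)_n / (q;q)_s, the quotient being
    [qpoch A s n]. *)
Definition shanks_term n s : {poly A} :=
  (-1) ^+ s * (qpoch A s n * 'X^(s * n + 'C(s.+1, 2))).

Lemma qpoch_recl s n : (s < n)%N -> qpoch A s n = (1 - 'X^(s.+1)) * qpoch A s.+1 n.
Proof. by move=> sn; rewrite /qpoch big_ltn. Qed.

Lemma qpoch_recr s n : (s <= n)%N -> qpoch A s n.+1 = qpoch A s n * (1 - 'X^(n.+1)).
Proof. by move=> sn; rewrite /qpoch big_nat_recr. Qed.

Lemma qpochnn n : qpoch A n n = 1.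
Proof. by rewrite /qpoch big_geq. Qed.

(** The differences telescope. For [m = n] what remains is the first of the two new pentagonal terms
    of [shanks]; the extra summand [s = n.+1] supplies the second. *)
Lemma shanks_step n m : (m <= n)%N ->
  \sum_(0 <= s < m.+1) (shanks_term n.+1 s - shanks_term n s) =
  (-1) ^+ m.+1 * (qpoch A m n * 'X^(m.+1 * n.+1 + 'C(m.+1, 2))).
Proof.
elim: m => [|m IHm] mn.
  rewrite big_nat1 /shanks_term qpoch_recr // !mul0n !mul1n bin_small //.
  rewrite !addn0 !expr0 expr1.
  by ring.
rewrite big_nat_recr //= IHm; last exact: ltnW.
rewrite /shanks_term qpoch_recr // (@qpoch_recl m n) //.
have -> : (m.+1 * n.+1 + 'C(m.+2, 2) = m.+1 + (m.+1 * n + 'C(m.+2, 2)))%N by lia.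
have -> : (m.+1 * n.+1 + 'C(m.+1, 2) = m.+1 * n + 'C(m.+2, 2))%N.
  by rewrite (binS m.+1 1) bin1; lia.
have -> : (m.+2 * n.+1 + 'C(m.+2, 2) = n.+1 + (m.+1 + (m.+1 * n + 'C(m.+2, 2))))%N by lia.
rewrite !exprD !(exprS _ m.+1) (exprS _ m).
ring.
Qed.

(* D. Shanks's finite form (1951) of the pentagonal number theorem: all terms of
   the left-hand side but the first, [qpoch A 0 n], have order greater than n. *)
Lemma shanks n :
  \sum_(0 <= s < n.+1) shanks_term n s =
  1 + \sum_(1 <= k < n.+1) (-1) ^+ k * ('X^(k * k + 'C(k, 2)) + 'X^(k * k + 'C(k.+1, 2))).
Proof.
elim: n => [|n IHn].
  by rewrite big_nat1 big_geq // /shanks_term qpochnn !mul1r addr0.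
rewrite [in RHS]big_nat_recr //= addrA -IHn big_nat_recr //=.
rewrite -[X in X + _](subrK (\sum_(0 <= s < n.+1) shanks_term n s)) -sumrB shanks_step //.
by rewrite /shanks_term !qpochnn; ring.
Qed.

(** The excluded exponents are k(3k-1)/2 and k(3k+1)/2; in [shanks] nothing else reaches degree
    [e <= n] besides the term [s = 0]. *)
Lemma pentagonal_coef n e : (e <= n)%N ->
  (forall k, e <> k * k + 'C(k, 2) /\ e <> k * k + 'C(k.+1, 2))%N ->
  (qpoch A 0 n)`_e = 0.
Proof.
move=> en he.
have := shanks n; rewrite big_nat_recl // {1}/shanks_term mul0n add0n mul1r mulr1.
move/(congr1 (fun p : {poly A} => p`_e)); rewrite !coefD !coef_sum.
rewrite big_nat big1 ?addr0 => [->|s /andP[_ sn]].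
  have e0 : e != 0%N by have [/eqP] := he 0%N; rewrite bin_small.
  rewrite coef1 (negPf e0) add0r big1 // => k _.
  have [/eqP h1 /eqP h2] := he k.
  by rewrite -polyCN -polyC_exp coefCM coefD !coefXn (negPf h1) (negPf h2) addr0 mulr0.
rewrite /shanks_term -polyCN -polyC_exp coefCM coefMXn ifT ?mulr0 //.
rewrite (leq_ltn_trans en) // (binS s.+1 1) bin1.
by rewrite mulSn; lia.
Qed.
End PentagonalNumbers.

(** * Arithmetic modulo 25 and modulo 5 *)

Lemma modn25_not_pentagonal n l k : (1 <= l <= 4)%N ->
  (25 * n + 5 * l + 1 <> k * k + 'C(k, 2) /\
   25 * n + 5 * l + 1 <> k * k + 'C(k.+1, 2))%N.
Proof.
move=> hl.
(* Doubling turns the pentagonal numbers into 3k^2 + k and 3k^2 - k, and 25n + 5l + 1 into 10l + 2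
   modulo 25. All residues [j] of [k] are tested; the second test has [j] on the left to avoid
   subtraction. *)
have /allP check : all (fun j => all (fun l =>
     ((10 * l + 2) %% 25 != (3 * j * j + j) %% 25)
  && ((10 * l + 2 + j) %% 25 != (3 * j * j) %% 25)) (iota 1 4))%N (iota 0 25).
  by [].
have /check/allP/(_ l) : (k %% 25)%N \in iota 0 25 by rewrite mem_iota ltn_mod.
rewrite mem_iota => /(_ hl) /andP[/eqP h1 /eqP h2].
have b1 : (2 * 'C(k, 2) + k = k * k)%N.
  by elim: (k) => [|m IHm]; rewrite // binS bin1; lia.
have b2 : (2 * 'C(k.+1, 2) = k * k + k)%N by rewrite binS bin1; lia.
have [a ea] : exists a, k = (a * 25 + k %% 25)%N by exists (k %/ 25)%N; rewrite -divn_eq.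
move: h1 h2 ea; move: (k %% 25)%N => j h1 h2 ea.
split=> e.
- apply: h2.
  have e2 : (10 * l + 2 + j + 25 * (2 * n + a) = 3 * k * k)%N by lia.
  have e3 : (3 * k * k = 3 * j * j + 25 * (3 * a * (25 * a + 2 * j)))%N.
    by rewrite ea; ring.
  move: (congr1 (modn^~ 25) (etrans e2 e3)).
  by rewrite ![(25 * _)%N]mulnC ![(_ + _ * 25)%N]addnC !modnMDl.
- apply: h1.
  have e2 : (10 * l + 2 + 25 * (2 * n) = 3 * k * k + k)%N by lia.
  have e3 : (3 * k * k + k = 3 * j * j + j + 25 * (3 * a * (25 * a + 2 * j) + a))%N.
    by rewrite ea; ring.
  move: (congr1 (modn^~ 25) (etrans e2 e3)).
  by rewrite ![(25 * _)%N]mulnC ![(_ + _ * 25)%N]addnC !modnMDl.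
Qed.

(** In characteristic 5 the 25th power is Frobenius applied twice, so (B X + c)^25 = B^25 X^25 +
    c^25, which suits induction on the polynomial. *)
Lemma coef_frobenius (B : {poly 'F_5}) j : ~~ (25 %| j)%N -> (B ^+ 25)`_j = 0.
Proof.
have ch : 5%N \in [pchar {poly 'F_5}] by rewrite pchar_poly pchar_Fp.
elim/poly_ind: B j => [|B c IH] j hj.
  by rewrite expr0n coef0.
rewrite (@exprDn_pchar _ _ _ 25); last by rewrite (@pnatX _ 5 2) /pnat /= ch.
rewrite exprMn coefD -polyC_exp coefC coefMXn.
case: ifP => hlt.
  by case: eqP hj => [->|]; rewrite ?dvdn0 ?add0r.
rewrite IH; last by rewrite dvdn_subl // leqNgt hlt.
by case: eqP hj => [->|]; rewrite ?dvdn0 ?add0r.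
Qed.

(** Over ['F_5] only coefficients of [B ^+ 25] at multiples of 25 survive, and each meets a
    coefficient of the Euler product at a non-pentagonal index. *)
Lemma dvdz5_coef (B : {poly int}) n l N :
  (1 <= l <= 4)%N -> N = (25 * n + 5 * l + 1)%N ->
  (5 %| (B ^+ 25 * qpoch int 0 N)`_N)%Z.
Proof.
move=> hl eN.
have -> : (5 %| (B ^+ 25 * qpoch int 0 N)`_N)%Z =
    (((B ^+ 25 * qpoch int 0 N)`_N)%:~R == 0 :> 'F_5).
  by rewrite (@dvdz_pcharf 'F_5 5) ?pchar_Fp.
rewrite -(coef_map (intr : int -> 'F_5)) rmorphM rmorphXn /=.
have -> : map_poly (intr : int -> 'F_5) (qpoch int 0 N) = qpoch _ 0 N.
  rewrite /qpoch rmorph_prod; apply: eq_bigr => k _.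
  by rewrite rmorphB rmorph1 /= map_polyXn.
rewrite coefM big1 // => -[j /= jN] _.
have [/dvdnP[a ea]|hj] := boolP (25 %| j)%N; last by rewrite coef_frobenius // mul0r.
rewrite pentagonal_coef ?mulr0 ?leq_subr // => k.
(* Since [5 * l + 1 < 25], the bound [25 * a <= N] forces [a <= n]. *)
have -> : (N - j = 25 * (n - a) + 5 * l + 1)%N by lia.
exact: modn25_not_pentagonal.
Qed.

(** * Approximation by integer polynomials near 0 *)

Section Approx.
Variable K : numFieldType.
Implicit Types (x y c : K) (f g : K -> K) (A B : {poly int}) (N : nat).

(** The bound 1/4 gives 2x <= 1/2: a geometric series of ratio 2x is at most twice its first term,
    and |1 - f x| <= 2x keeps [f] away from 0. *)
Local Notation small x := (0 < x <= 4^-1).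
Local Notation "A ^K" := (map_poly (intr : int -> K) A) (at level 2, format "A ^K").

Lemma small_bounds x : small x -> [/\ 0 < x, 0 <= x, x <= 1 & 4 * x <= 1].
Proof.
move=> /andP[x0 x1]; have h4 : 4 * x <= 1 by rewrite -ler_pdivlMl ?mulr1.
split=> //; first exact: ltW.
by apply: le_trans x1 _; rewrite invf_le1 ?ler1n ?ltr0n.
Qed.

Lemma poly_bounded_small (D : {poly K}) :
  exists2 C, 0 <= C & forall x, small x -> `|D.[x]| <= C.
Proof.
elim/poly_ind: D => [|D c [C C0 hC]].
  by exists 0 => // x _; rewrite horner0 normr0.
exists (C + `|c|); first by rewrite addr_ge0.
move=> x sx; have [_ x0 x1 _] := small_bounds sx.
rewrite !hornerE (le_trans (ler_normD _ _)) // lerD2r normrM (ger0_norm x0).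
by rewrite -[leRHS]mulr1 ler_pM // hC.
Qed.

Lemma le_small_eq0 c (M : K) :
  0 <= M -> (forall x, small x -> `|c| <= M * x) -> c = 0.
Proof.
move=> M0 hM; apply/eqP/negPn/negP; rewrite -normr_gt0 => c0.
(* This [d] makes x = |c| / d at most 1/4 and M x smaller than |c|, so one point suffices for the
   contradiction. *)
set d := 4 * `|c| + M + 1.
have d0 : 0 < d by rewrite ltr_wpDl // addr_ge0 // mulr_ge0.
have sx : small (`|c| / d).
  rewrite divr_gt0 //= ler_pdivrMr // ler_pdivlMl // /d -addrA lerDl.
  by rewrite addr_ge0.
have := hM _ sx; rewrite mulrA ler_pdivlMr // mulrC ler_pM2r //.
rewrite -subr_ge0 /d => h.
suff: 0 <= - (4 * `|c| + 1) by rewrite oppr_ge0 lt_geF // ltr_wpDl // mulr_ge0.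
by move: h; congr (0 <= _); ring.
Qed.

(** The constant coefficient is O(x), hence 0; dividing by [x] then lowers both the degree and [N]
    by one. *)
Lemma coef_eq0_of_small N (D : {poly K}) (C : K) : 0 <= C ->
    (forall x, small x -> `|D.[x]| <= C * x ^+ N.+1) ->
  forall i, (i <= N)%N -> D`_i = 0.
Proof.
move=> C0; elim/poly_ind: D N => [|D c IHD] N hD i iN; first by rewrite coef0.
have c0 : c = 0.
  have [M M0 hM] := poly_bounded_small D.
  apply: (@le_small_eq0 _ (M + C)) => [|x sx]; first by rewrite addr_ge0.
  have [_ x0 x1 _] := small_bounds sx.
  have := hD x sx; rewrite !hornerE => h.
  rewrite -[c](addKr (D.[x] * x)) (le_trans (ler_normD _ _)) // mulrDl lerD //.
    by rewrite normrN normrM (ger0_norm x0) ler_wpM2r // hM.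
  rewrite (le_trans h) // exprS ler_wpM2l // -[leRHS]mulr1 ler_wpM2l //.
  exact: exprn_ile1.
rewrite coefD coefMX coefC c0.
case: i iN => [|i] iN /=; rewrite addr0 //.
case: N iN hD => // N iN hD; apply: (IHD N) => // x sx.
have [x0 x0' _ _] := small_bounds sx.
rewrite -(ler_pM2r x0) -mulrA -exprSr -[X in _ * X <= _](ger0_norm x0') -normrM.
by have := hD x sx; rewrite c0 !hornerE.
Qed.

(* [f x = A(x) + O(x ^ (N + 1))] on [0 < x <= 1/4]. *)
Definition approx N f A :=
  exists2 C, 0 <= C & forall x, small x -> `|f x - A^K.[x]| <= C * x ^+ N.+1.

Lemma approx_ext N f g A :
  (forall x, small x -> f x = g x) -> approx N f A -> approx N g A.
Proof. by move=> fg [C C0 hC]; exists C => // x sx; rewrite -fg ?hC. Qed.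

Lemma approx_bounded N f A : approx N f A ->
  exists2 C, 0 <= C & forall x, small x -> `|f x| <= C.
Proof.
move=> [C C0 hC]; have [M M0 hM] := poly_bounded_small A^K.
exists (C + M) => [|x sx]; first exact: addr_ge0.
have [_ x0 x1 _] := small_bounds sx.
rewrite -[f x](subrK A^K.[x]) (le_trans (ler_normD _ _)) // lerD ?hM //.
by rewrite (le_trans (hC x sx)) // -[leRHS]mulr1 ler_wpM2l // exprn_ile1.
Qed.

Lemma approx1 N : approx N (fun=> 1) 1.
Proof. by exists 0 => // x _; rewrite rmorph1 hornerC subrr normr0 mul0r. Qed.

Lemma approxD N f g A B :
  approx N f A -> approx N g B -> approx N (fun x => f x + g x) (A + B).
Proof.
move=> [C C0 hC] [M M0 hM]; exists (C + M) => [|x sx]; first exact: addr_ge0.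
rewrite rmorphD hornerD opprD addrACA (le_trans (ler_normD _ _)) // mulrDl.
by rewrite lerD ?hC ?hM.
Qed.

Lemma approxN N f A : approx N f A -> approx N (fun x => - f x) (- A).
Proof.
move=> [C C0 hC]; exists C => // x sx.
by rewrite rmorphN hornerN -opprD normrN hC.
Qed.

Lemma approxM N f g A B :
  approx N f A -> approx N g B -> approx N (fun x => f x * g x) (A * B).
Proof.
move=> hf hg; have [C C0 hC] := hf; have [M M0 hM] := hg.
have [G G0 hG] := approx_bounded hg; have [F F0 hF] := poly_bounded_small A^K.
exists (C * G + F * M) => [|x sx]; first by rewrite addr_ge0 // mulr_ge0.
have [_ x0 _ _] := small_bounds sx.
have -> : f x * g x - (A * B)^K.[x] =
    (f x - A^K.[x]) * g x + A^K.[x] * (g x - B^K.[x]).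
  by rewrite rmorphM hornerM; ring.
rewrite (le_trans (ler_normD _ _)) // !normrM mulrDl lerD // -mulrA.
  by rewrite mulrCA mulrC (mulrC G) mulrC ler_pM ?hC ?hG.
by rewrite ler_pM ?hF ?hM.
Qed.

Lemma approxX N f A n : approx N f A -> approx N (fun x => f x ^+ n) (A ^+ n).
Proof.
move=> hf; elim: n => [|n IHn]; first exact: approx1.
by have := approxM hf IHn; rewrite -exprS; apply: approx_ext => x _; rewrite exprS.
Qed.

Lemma approx_sum N (h : nat -> K -> K) (H : nat -> {poly int}) n :
  (forall j, approx N (h j) (H j)) ->
  approx N (fun x => \sum_(j < n) h j x) (\sum_(j < n) H j).
Proof.
move=> hh; elim: n => [|n IHn].
  rewrite big_ord0; exists 0 => // x _.
  by rewrite big_ord0 rmorph0 horner0 subrr normr0 mul0r.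
rewrite big_ord_recr /=; have := approxD IHn (hh n).
by apply: approx_ext => x _; rewrite big_ord_recr.
Qed.

(* The polynomial is the truncated geometric series of [1 - A]. *)
Lemma approxV N f A : (forall x, small x -> `|1 - f x| <= 2 * x) ->
  approx N f A -> exists B, approx N (fun x => (f x)^-1) B.
Proof.
move=> hf1 hf.
exists (\sum_(j < N.+1) (1 - A) ^+ j).
have [C C0 hC] : approx N (fun x => \sum_(j < N.+1) (1 - f x) ^+ j)
    (\sum_(j < N.+1) (1 - A) ^+ j).
  apply: (@approx_sum N (fun j x => (1 - f x) ^+ j) (fun j => (1 - A) ^+ j)) => j.
  apply: (@approxX N (fun x => 1 - f x)); apply: approxD; first exact: approx1.
  exact: approxN.
(* The factor 2 bounds |1 / f x| and [2 ^+ N.+1] comes from (2x)^(N+1), both in the remainder of the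
   geometric series; [C] is the error of the truncated series. *)
exists (2 * 2 ^+ N.+1 + C) => [|x sx].
  by rewrite addr_ge0 // mulr_ge0 ?exprn_ge0.
have [_ x0 _ x4] := small_bounds sx.
have fx : 2^-1 <= `|f x|.
  have h := hf1 x sx.
  have : 1 <= `|f x| + 2 * x.
    rewrite -[leLHS]normr1 -[X in `|X|](subrK (f x)) (le_trans (ler_normD _ _)) //.
    by rewrite addrC lerD2l.
  rewrite -lerBlDr; apply: le_trans; rewrite lerBrDr.
  rewrite -(ler_pM2l (x := 2)) // mulrDr mulfV // mulr1 mulrA -natrM.
  by rewrite -[leRHS](natrD K 1 1) lerD2l.
have f0 : f x != 0 by rewrite -normr_gt0 (lt_le_trans _ fx) // invr_gt0.
have e : (f x)^-1 - \sum_(j < N.+1) (1 - f x) ^+ j = (f x)^-1 * (1 - f x) ^+ N.+1.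
  have := subrX1 (1 - f x) N.+1; set S := \sum_(_ < _) _; set u := _ ^+ _ => h.
  have -> : u = 1 - f x * S by rewrite -[u](subrK 1) h; ring.
  by field.
rewrite -[X in X - _](subrK (\sum_(j < N.+1) (1 - f x) ^+ j)) -addrA.
rewrite (le_trans (ler_normD _ _)) // mulrDl lerD ?hC // e normrM -mulrA -exprMn.
rewrite ler_pM //; last by rewrite normrX lerXn2r ?nnegrE ?mulr_ge0 // hf1.
by rewrite normfV -[leRHS]invrK lef_pV2 ?posrE ?normr_gt0 // invr_gt0.
Qed.

(** * Limits, power series and partial products *)

Lemma cvgn_dist_le (u : nat -> K) (l v M : K) n0 : (u @ \oo --> l)%classic ->
  (forall n, (n0 <= n)%N -> `|u n - v| <= M) -> `|l - v| <= M.
Proof.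
move=> /cvgrPdist_lt ul hu.
(* The order of [K] may be partial; [M] bounds a norm, so it is real and comparable with norms. *)
have Mr : M \is Num.real by rewrite ger0_real // (le_trans _ (hu n0 _)).
rewrite real_leNgt // -subr_gt0; apply/negP => /ul[n1 _ hn1].
have := hn1 (maxn n0 n1) (leq_maxr _ _).
have h := hu (maxn n0 n1) (leq_maxl _ _).
rewrite /= ltrBrDr => h2; have := lt_le_trans h2 (ler_distD (u (maxn n0 n1)) l v).
by rewrite ltrD2l real_ltNge // h.
Qed.

Lemma dist_is_cvgn (u : nat -> K) (l : K) :
  (forall e, 0 < e -> exists n0, forall n, (n0 <= n)%N -> `|l - u n| < e) -> cvgn u.
Proof.
move=> ul; apply/cvg_ex; exists l; apply/cvgrPdist_lt => e /ul[n0 hn].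
by exists n0.
Qed.

Lemma geometric_le y m d : 0 <= y -> 2 * y <= 1 ->
  \sum_(m <= k < m + d) y ^+ k <= 2 * y ^+ m.
Proof.
move=> y0 y1; elim: d m => [|d IHd] m.
  by rewrite addn0 big_geq // mulr_ge0 // exprn_ge0.
rewrite big_ltn; last by rewrite -addSnnS leq_addr.
rewrite -addSnnS mulr_natl mulr2n lerD2l (le_trans (IHd _)) //.
by rewrite exprS mulrA ler_piMl // exprn_ge0.
Qed.

(** Convergence at q = 1/2 bounds [p n] by a multiple of 2^n, so the tail beyond degree [N] is
    dominated by a geometric series of ratio 2x. *)
Lemma power_series_approx (p : nat -> K) f N :
  (forall q, `|q| < 1 -> (series (fun n => p n * q ^+ n) @ \oo --> f q)%classic) ->
  exists2 C, 0 <= C & forall x, small x ->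
    `|f x - (\poly_(k < N.+1) p k).[x]| <= C * x ^+ N.+1.
Proof.
move=> hp.
have h2 : `|2^-1 : K| < 1 by rewrite ger0_norm ?invr_ge0 // invf_lt1 // ltr1n.
have [C C0 hC] : exists2 C, 0 <= C & forall n, `|p n| <= C * 2 ^+ n.
  have /cvg_series_cvg_0 : cvgn (series (fun n => p n * 2^-1 ^+ n)).
    by apply/cvg_ex; eexists; exact: (hp _ h2).
  move=> h0; have /cvg_seq_bounded : cvgn (fun n => p n * 2^-1 ^+ n).
    by apply/cvg_ex; eexists; exact: h0.
  move=> /pinfty_ex_gt0[C C0 hC]; exists C => [|n]; first exact: ltW.
  have := hC n I; rewrite /= normrM normrX (@ger0_norm _ 2^-1) ?invr_ge0 // exprVn.
  by rewrite ler_pdivrMr // exprn_gt0.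
exists (C * (2 * 2 ^+ N.+1)) => [|x sx]; first by rewrite !mulr_ge0 // exprn_ge0.
have [x0 x0' x1 x4] := small_bounds sx.
apply: (@cvgn_dist_le _ _ _ _ N.+1 (hp x _)) => [|n hn].
  rewrite ger0_norm // -(ltr_pM2l (x := 4)) // mulr1 (le_lt_trans x4) // ltr1n //.
rewrite horner_poly -(big_mkord xpredT (fun k => p k * x ^+ k)) /series /=.
rewrite [X in X - _](@big_cat_nat _ _ _ N.+1) //= [X in `|X|]addrC addKr.
rewrite (le_trans (ler_norm_sum _ _ _)) //.
have -> : C * (2 * 2 ^+ N.+1) * x ^+ N.+1 = C * (2 * (2 * x) ^+ N.+1).
  by rewrite exprMn; ring.
rewrite -[n](subnKC hn).
apply: (@le_trans _ _ (C * \sum_(N.+1 <= k < N.+1 + (n - N.+1)) (2 * x) ^+ k)).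
  rewrite mulr_sumr ler_sum // => k _.
  by rewrite normrM normrX (ger0_norm x0') exprMn mulrA ler_wpM2r // exprn_ge0.
rewrite ler_wpM2l // geometric_le ?mulr_ge0 //.
by rewrite mulrA -natrM.
Qed.

Definition qprod x n : K := \prod_(1 <= k < n.+1) (1 - x ^+ k).

Lemma qprodS x n : qprod x n.+1 = qprod x n * (1 - x ^+ n.+1).
Proof. by rewrite /qprod big_nat_recr. Qed.

Lemma qprod_bounds x n : 0 <= x -> x <= 1 -> 0 <= qprod x n <= 1.
Proof.
move=> x0 x1; elim: n => [|n /andP[h0 h1]]; first by rewrite /qprod big_geq ?ler01 /=.
have y0 : 0 <= 1 - x ^+ n.+1 by rewrite subr_ge0 exprn_ile1.
rewrite qprodS mulr_ge0 //= mulr_ile1 //.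
by rewrite lerBlDr lerDl exprn_ge0.
Qed.

(** The partial products lie in [0, 1], so the factor 1 - x^k moves them by at most x^k, and these
    changes add up to a geometric tail. *)
Lemma qprod_dist x N n : small x -> (N <= n)%N ->
  `|qprod x n - qprod x N| <= 2 * x ^+ N.+1.
Proof.
move=> sx Nn; have [_ x0 x1 x4] := small_bounds sx.
rewrite -(subnKC Nn); apply: le_trans (geometric_le _ (n - N) x0 _); last first.
  by rewrite (le_trans _ x4) // ler_wpM2r // ler_nat.
elim: (n - N)%N => [|d IHd].
  by rewrite addn0 subrr normr0 sumr_ge0 // => i _; rewrite exprn_ge0.
have [/andP[q0 q1]] : 0 <= qprod x (N + d) <= 1 by exact: qprod_bounds.
rewrite (addnS N) (addnS N.+1) qprodS big_nat_recr /=; last by rewrite leq_addr.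
rewrite mulrBr mulr1 addrAC (le_trans (ler_normB _ _)) // lerD //.
by rewrite addSn normrM normrX (ger0_norm x0) (ger0_norm q0) ler_piMl // exprn_ge0.
Qed.

End Approx.

Lemma horner_qpoch (K : numFieldType) (x : K) n :
  (map_poly intr (qpoch int 0 n)).[x] = qprod x n.
Proof.
rewrite /qpoch /qprod big_add1 /= rmorph_prod horner_prod; apply: eq_bigr => k _.
by rewrite rmorphB rmorph1 /= map_polyXn !hornerE.
Qed.

(** * The infinite product over the complex numbers *)

Section Complex.
Variable R : realType.
(* The topology is that of [R[i]] as an abstract [numFieldType], as in [qpoch_inf]. *)
Local Notation C := (R[i] : numFieldType).
Implicit Types x : C.

Lemma is_cvgn_real_complex (u : nat -> R) :
  cvgn u -> cvgn (fun n => (u n)%:C : C).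
Proof.
move=> /cvg_ex[/= l /cvgrPdist_lt ul]; apply: (@dist_is_cvgn _ _ (l%:C)) => e e0.
(* In the order of [R[i]] a positive element has zero imaginary part. *)
have [er e'0] : e = (complex.Re e)%:C /\ 0 < complex.Re e.
  by move: e0; case: (e) => a b; rewrite ltcE /= => /andP[/eqP -> ?].
have [n _ hn] := ul _ e'0; exists n => // m nm.
rewrite /= -rmorphB normc_def /= expr0n addr0 sqrtr_sqr er ltcR.
exact: hn.
Qed.

(** The [limn] in [qpoch_inf] is informative only under convergence; here the partial products are
    real, nonincreasing and nonnegative. *)
Lemma is_cvgn_qprod x : 0 <= x <= 1 -> cvgn (qprod x).
Proof.
case: x => t s; rewrite !lecE /= => /andP[/andP[/eqP -> t0] /andP[_ t1]].
have -> : qprod (t +i* 0) = fun n => (qprod t n)%:C.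
  apply/funext => n; rewrite /qprod rmorph_prod; apply: eq_bigr => k _.
  by rewrite rmorphB rmorph1 rmorphXn.
apply/is_cvgn_real_complex/nonincreasing_is_cvgn.
  apply/nonincreasing_seqP => n; have /andP[q0 _] := qprod_bounds n t0 t1.
  by rewrite qprodS ler_piMr // lerBlDr lerDl exprn_ge0.
by exists 0 => _ [n _ <-]; have /andP[] := qprod_bounds n t0 t1.
Qed.

Lemma qpoch_inf_dist N x : 0 < x <= 4^-1 ->
  `|qpoch_inf x - qprod x N| <= 2 * x ^+ N.+1.
Proof.
move=> sx; have [_ x0 x1 _] := small_bounds sx.
apply: (@cvgn_dist_le _ (qprod x) _ _ _ N) => [|n]; last exact: qprod_dist.
by apply: is_cvgn_qprod; rewrite x0.
Qed.

Lemma qpoch_inf_dist1 x : 0 < x <= 4^-1 -> `|1 - qpoch_inf x| <= 2 * x.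
Proof.
by move=> /(qpoch_inf_dist 0); rewrite /qprod big_geq // distrC expr1.
Qed.

Lemma qpoch_inf_neq0 x : 0 < x <= 4^-1 -> qpoch_inf x != 0.
Proof.
move=> sx; have [_ x0 _ x4] := small_bounds sx.
apply/eqP => q0; have := qpoch_inf_dist1 sx; rewrite q0 subr0 normr1.
rewrite -(ler_pM2l (x := 2)) // mulrA -natrM mulr1 => /le_trans/(_ x4).
by rewrite lern1.
Qed.

Lemma approx_qpoch_inf N : approx N (@qpoch_inf C) (qpoch int 0 N).
Proof.
by exists 2 => // x sx; rewrite horner_qpoch qpoch_inf_dist.
Qed.

Lemma approx_qpoch_inf_exprz N (z : int) :
  exists B, approx N (fun x : C => qpoch_inf x ^ z) B.
Proof.
case: z => n; first by exists (qpoch int 0 N ^+ n); apply/approxX/approx_qpoch_inf.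
(* The exponent is now [Negz n], that is -(n + 1), hence the power [n.+1] of the inverse. *)
have [B hB] := approxV qpoch_inf_dist1 (approx_qpoch_inf N).
exists (B ^+ n.+1); apply: approx_ext (approxX n.+1 hB) => x _.
by rewrite exprVn.
Qed.

(** The truncated series and [A] both equal [f] up to O(x^(N+1)), so their difference has zero
    coefficients up to degree [N]. *)
Lemma approx_coef (p : nat -> C) f N A :
    (forall q, `|q| < 1 -> (series (fun n => p n * q ^+ n) @ \oo --> f q)%classic) ->
  approx N f A -> p N = (A`_N)%:~R.
Proof.
move=> /(@power_series_approx _ p f N)[L L0 hL] [M M0 hM].
apply/eqP; rewrite -subr_eq0; apply/eqP.
have := @coef_eq0_of_small _ N (\poly_(k < N.+1) p k - map_poly intr A) (L + M).
rewrite addr_ge0 // => /(_ isT) h; have := h _ N (leqnn N).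
rewrite coefB coef_poly ltnSn coef_map; apply=> x sx.
rewrite hornerD hornerN -[X in `|X - _|](subrK (f x)) -addrA.
by rewrite (le_trans (ler_normD _ _)) // mulrDl lerD ?hM // distrC hL.
Qed.

End Complex.

Theorem theorem1p4 (R : realType) (lambda : int)
    (hlambda : 25 * lambda + 1 != 0)
    (p : nat -> R[i])
    (hp : is_general_partition_function (- (25 * lambda + 1)) p)
    (n l : nat) (hl : (1 <= l <= 4)%N) :
  exists2 m : int, p (25 * n + 5 * l + 1)%N = m%:~R & (m = 0 %[mod 5])%Z.
Proof.
set N := (25 * n + 5 * l + 1)%N.
have [B hB] := approx_qpoch_inf_exprz R N lambda.
exists (B ^+ 25 * qpoch int 0 N)`_N; last first.
  by rewrite mod0z; apply/dvdz_mod0P/(dvdz5_coef _ hl).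
apply: approx_coef hp _.
apply: approx_ext (approxM (approxX 25 hB) (approx_qpoch_inf R N)) => x sx.
(* The reciprocal cancels the minus sign of the exponent; splitting 25 lambda + 1 requires a nonzero
   base, as lambda may be negative. *)
have q0 := qpoch_inf_neq0 sx.
by rewrite div1r invr_expz opprK expfzDr // expr1z [25 * lambda]mulrC -exprz_exp.
Qed.
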